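(* Let $n$ be a positive integer and let $STVH_n=\ker(\varphi_2)$. Then $STVH_n$ has a monoid presentation with generators the elements $x_{kl}$, $x_{kl}^{-1}$, $z_{kl}$ ($1\le k\neq l\le n$) and $\gamma_j$ ($1\le j\le n$), and with the following defining relations, where distinct letters denote distinct indices in $\{1,\dots,n\}$ unless stated otherwise and each relation is imposed for all such choices of indices: $$\gamma_i^2=e\ (1\le i\le n),\qquad \gamma_i\gamma_j=\gamma_j\gamma_i\ (1\le i,j\le n),$$ $$x_{ij}x_{ij}^{-1}=e=x_{ij}^{-1}x_{ij},$$ $$x_{ij}x_{kl}=x_{kl}x_{ij},$$ $$x_{ik}x_{kj}x_{ik}=x_{kj}x_{ik}x_{kj},$$ $$x_{ij}\gamma_k=\gamma_kx_{ij},$$ $$x_{ij}=\gamma_i\gamma_jx_{ji}\gamma_j\gamma_i,$$ $$x_{ij}z_{kl}=z_{kl}x_{ij},$$ $$x_{ik}x_{kj}z_{ik}=z_{kj}x_{ik}x_{kj},$$ $$z_{ik}x_{kj}x_{ik}=x_{kj}x_{ik}z_{kj},$$ $$x_{ij}z_{ij}=z_{ij}x_{ij},$$ $$z_{ij}z_{kl}=z_{kl}z_{ij},$$ $$z_{ij}\gamma_k=\gamma_kz_{ij},$$ $$z_{ij}=\gamma_i\gamma_jz_{ji}\gamma_j\gamma_i.$$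
   Context: The singular twisted virtual braid monoid $STVB_n$ is the monoid with identity $e$, generators $\sigma_i,\sigma_i^{-1},\rho_i,\tau_i$ ($1\le i\le n-1$) and $\gamma_i$ ($1\le i\le n$), and the following defining relations (for all indices for which they make sense): (1) $\sigma_i\sigma_i^{-1}=\sigma_i^{-1}\sigma_i=e$, $\rho_i^2=e$, $\gamma_i^2=e$; (2) for $|i-j|>1$: $\sigma_i\sigma_j=\sigma_j\sigma_i$, $\rho_i\rho_j=\rho_j\rho_i$, $\sigma_i\rho_j=\rho_j\sigma_i$, $\tau_i\tau_j=\tau_j\tau_i$, $\sigma_i\tau_j=\tau_j\sigma_i$, $\tau_i\rho_j=\rho_j\tau_i$; (3) for $1\le i\le n-2$: $\sigma_i\sigma_{i+1}\sigma_i=\sigma_{i+1}\sigma_i\sigma_{i+1}$, $\rho_i\rho_{i+1}\rho_i=\rho_{i+1}\rho_i\rho_{i+1}$, $\rho_i\sigma_{i+1}\rho_i=\rho_{i+1}\sigma_i\rho_{i+1}$, $\rho_i\tau_{i+1}\rho_i=\rho_{i+1}\tau_i\rho_{i+1}$, $\sigma_i\sigma_{i+1}\tau_i=\tau_{i+1}\sigma_i\sigma_{i+1}$, $\sigma_{i+1}\sigma_i\tau_{i+1}=\tau_i\sigma_{i+1}\sigma_i$; (4) $\sigma_i\tau_i=\tau_i\sigma_i$ for $1\le i\le n-1$; (5) $\gamma_i\gamma_j=\gamma_j\gamma_i$ for $1\le i,j\le n$; and for $j\ne i,i+1$: $\gamma_j\rho_i=\rho_i\gamma_j$, $\gamma_j\sigma_i=\sigma_i\gamma_j$,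 $\gamma_j\tau_i=\tau_i\gamma_j$; (6) for $1\le i\le n-1$: $\gamma_{i+1}\rho_i=\rho_i\gamma_i$, $\rho_i\sigma_i\rho_i=\gamma_{i+1}\gamma_i\sigma_i\gamma_i\gamma_{i+1}$, $\rho_i\tau_i\rho_i=\gamma_{i+1}\gamma_i\tau_i\gamma_i\gamma_{i+1}$. $S_n$ is the symmetric group, generated by the adjacent transpositions $\rho_i=(i,i+1)$, $1\le i\le n-1$. The homomorphism $\varphi_2:STVB_n\to S_n$ is given by $\sigma_i^{\pm1}\mapsto e$, $\tau_i\mapsto e$, $\rho_i\mapsto\rho_i$, $\gamma_j\mapsto e$. Its kernel is the submonoid of elements mapped to the identity. The generators are the following elements of $STVB_n$. For $1\le i<j\le n$, with $w=\rho_{j-1}\rho_{j-2}\cdots\rho_{i+1}$ and $w'=\rho_{i+1}\cdots\rho_{j-2}\rho_{j-1}$ (both empty if $j=i+1$): $x_{i,j}=w\,\sigma_i\,w'$, $x_{j,i}=w\,\rho_i\sigma_i\rho_i\,w'$, $z_{i,j}=w\,\tau_i\,w'$, $z_{j,i}=w\,\rho_i\tau_i\rho_i\,w'$. In particular $x_{i,i+1}=\sigma_i$, $x_{i+1,i}=\rho_i\sigma_i\rho_i$, $z_{i,i+1}=\tau_i$, $z_{i+1,i}=\rho_i\tau_i\rho_i$. The element $x_{kl}^{-1}$ is the inverse of $x_{kl}$ in $STVB_n$. We also write $x_{kl}=x_{k,l}$ and $z_{kl}=z_{k,l}$. *)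

(* Defs.v *)
From HB Require Import structures.
From mathcomp Require Import all_boot all_fingroup.
From mathcomp Require Import generic_quotient boolp zify.

Set Implicit Arguments.
Unset Strict Implicit.
Unset Printing Implicit Defensive.

Local Open Scope group_scope.
Local Open Scope quotient_scope.

Section Presentation.
Variables (A : choiceType) (R : seq A -> seq A -> Prop).

(* The congruence generated by [R] on the free monoid [seq A]. *)
Inductive cong : seq A -> seq A -> Prop :=
| cong_rel u v : R u v -> cong u v
| cong_refl u : cong u u
| cong_sym u v : cong u v -> cong v u
| cong_trans u v w : cong u v -> cong v w -> cong u w
| cong_cat u u' v v' : cong u u' -> cong v v' -> cong (u ++ v) (u' ++ v').

Definition congb : rel (seq A) := fun u v => `[< cong u v >].

Lemma congb_refl : reflexive congb.
Proof. by move=> u; apply/asboolP; exact: cong_refl. Qed.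

Lemma congb_sym : symmetric congb.
Proof. by move=> u v; apply/asboolP/asboolP; exact: cong_sym. Qed.

Lemma congb_trans : transitive congb.
Proof.
move=> v u w /asboolP uv /asboolP vw.
by apply/asboolP; exact: cong_trans uv vw.
Qed.

Canonical congb_equiv := EquivRel congb congb_refl congb_sym congb_trans.

Definition presented := {eq_quot congb}.
HB.instance Definition _ := Choice.on presented.
HB.instance Definition _ := EqQuotient.on presented.

Definition pword (u : seq A) : presented := \pi_presented u.
Definition pgen (a : A) : presented := pword [:: a].

Lemma pwordP u v : reflect (cong u v) (pword u == pword v).
Proof. by rewrite /pword piE /=; exact: asboolP. Qed.

Lemma pword_eq u v : cong u v -> pword u = pword v.
Proof. by move=> uv; apply/eqP/pwordP. Qed.

Lemma pword_repr (q : presented) : pword (repr q) = q.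
Proof. exact: reprK. Qed.

Lemma cong_repr u : cong (repr (pword u)) u.
Proof. by apply/pwordP; rewrite pword_repr. Qed.

Definition pmul (p q : presented) : presented := pword (repr p ++ repr q).

Lemma pmul_pword u v : pmul (pword u) (pword v) = pword (u ++ v).
Proof. by apply/pword_eq/cong_cat; exact: cong_repr. Qed.

Lemma pmulA : associative pmul.
Proof.
move=> p q r; rewrite -(pword_repr p) -(pword_repr q) -(pword_repr r).
by rewrite !pmul_pword catA.
Qed.

Lemma pmul1g : left_id (pword [::]) pmul.
Proof. by move=> p; rewrite -(pword_repr p) pmul_pword. Qed.

Lemma pmulg1 : right_id (pword [::]) pmul.
Proof. by move=> p; rewrite -(pword_repr p) pmul_pword cats0. Qed.

HB.instance Definition _ := isMonoid.Build presented pmulA pmul1g pmulg1.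

Lemma pwordM u v : pword (u ++ v) = pword u * pword v.
Proof. by rewrite -pmul_pword. Qed.

Lemma pword1 : pword [::] = 1.
Proof. by []. Qed.

End Presentation.

Section UniversalProperty.
Variables (A : choiceType) (R : seq A -> seq A -> Prop).
Variables (M : monoidType) (g : A -> M).

Definition weval (u : seq A) : M := \prod_(a <- u) g a.

Definition plift (q : presented R) : M := weval (repr q).

Hypothesis gR : forall u v, R u v -> weval u = weval v.

Lemma weval_cong u v : cong R u v -> weval u = weval v.
Proof.
elim=> // {u v} [u v w _ -> //|u u' v v' _ IHu _ IHv].
by rewrite /weval !big_cat /=; congr (_ * _).
Qed.

Lemma plift_pword u : plift (pword R u) = weval u.
Proof. exact/weval_cong/cong_repr. Qed.

Lemma plift_monoid_morphism : monoid_morphism plift.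
Proof.
split=> [|p q]; first by rewrite -pword1 plift_pword /weval big_nil.
rewrite -(pword_repr p) -(pword_repr q) -pwordM !plift_pword.
by rewrite /weval big_cat.
Qed.

End UniversalProperty.

(* [M] has the presentation < A | R >, the generator [a] standing for the
   element [g a] of [M]. *)
Definition has_presentation (M : monoidType) (A : choiceType) (g : A -> M)
    (R : seq A -> seq A -> Prop) : Prop :=
  exists f : UMagmaMorphism.type (presented R) M,
    (forall a, f (pgen R a) = g a) /\ bijective f.

Section Kernel.
Variables (M N : monoidType) (f : UMagmaMorphism.type M N).

Definition mon_ker : {pred M} := [pred x | f x == 1].

Lemma mon_ker_closed : monoid_closed mon_ker.
Proof.
split=> [|x y]; rewrite !inE ?gmulf1 // => /eqP fx /eqP fy.
by rewrite gmulfM fx fy mulg1.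
Qed.

HB.instance Definition _ := isMulClosed.Build M mon_ker mon_ker_closed.2.
HB.instance Definition _ := isMul1Closed.Build M mon_ker mon_ker_closed.1.

Definition kernel := {x : M | x \in mon_ker}.
HB.instance Definition _ := SubChoice.on kernel.
HB.instance Definition _ := SubChoice_isSubMonoid.Build M mon_ker kernel mon_ker_closed.

End Kernel.

(* Strands are numbered 0, ..., n - 1, so [Sigma i], with [i < n - 1], involves
   the strands [i] and [i + 1]. *)
Inductive stvb_gen (n : nat) : Type :=
| Sigma of 'I_n.-1
| SigmaInv of 'I_n.-1
| Rho of 'I_n.-1
| Tau of 'I_n.-1
| Gamma of 'I_n.

HB.instance Definition _ n := gen_eqMixin (stvb_gen n).
HB.instance Definition _ n := gen_choiceMixin (stvb_gen n).

Section STVB.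
Variable n : nat.
Local Open Scope nat_scope.

Lemma strand_proof (i : 'I_n.-1) : i < n.
Proof. exact: leq_trans (ltn_ord i) (leq_pred n). Qed.

Lemma strandS_proof (i : 'I_n.-1) : i.+1 < n.
Proof. by case: i => i /=; case: n. Qed.

Definition strand (i : 'I_n.-1) : 'I_n := Ordinal (strand_proof i).
Definition strandS (i : 'I_n.-1) : 'I_n := Ordinal (strandS_proof i).

Definition far (i j : 'I_n.-1) : bool := (i.+1 < j) || (j.+1 < i).

Implicit Types (i j : 'I_n.-1) (p q : 'I_n).

Local Notation S := (@Sigma n).
Local Notation S' := (@SigmaInv n).
Local Notation R := (@Rho n).
Local Notation T := (@Tau n).
Local Notation G := (@Gamma n).

Inductive stvb_rel : seq (stvb_gen n) -> seq (stvb_gen n) -> Prop :=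
| stvb_sigmaK i : stvb_rel [:: S i; S' i] [::]
| stvb_sigmaVK i : stvb_rel [:: S' i; S i] [::]
| stvb_rhoK i : stvb_rel [:: R i; R i] [::]
| stvb_gammaK p : stvb_rel [:: G p; G p] [::]
| stvb_far_ss i j : far i j -> stvb_rel [:: S i; S j] [:: S j; S i]
| stvb_far_rr i j : far i j -> stvb_rel [:: R i; R j] [:: R j; R i]
| stvb_far_sr i j : far i j -> stvb_rel [:: S i; R j] [:: R j; S i]
| stvb_far_tt i j : far i j -> stvb_rel [:: T i; T j] [:: T j; T i]
| stvb_far_st i j : far i j -> stvb_rel [:: S i; T j] [:: T j; S i]
| stvb_far_tr i j : far i j -> stvb_rel [:: T i; R j] [:: R j; T i]
| stvb_sss i j : j = i.+1 :> nat ->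
    stvb_rel [:: S i; S j; S i] [:: S j; S i; S j]
| stvb_rrr i j : j = i.+1 :> nat ->
    stvb_rel [:: R i; R j; R i] [:: R j; R i; R j]
| stvb_rsr i j : j = i.+1 :> nat ->
    stvb_rel [:: R i; S j; R i] [:: R j; S i; R j]
| stvb_rtr i j : j = i.+1 :> nat ->
    stvb_rel [:: R i; T j; R i] [:: R j; T i; R j]
| stvb_sst i j : j = i.+1 :> nat ->
    stvb_rel [:: S i; S j; T i] [:: T j; S i; S j]
| stvb_sst' i j : j = i.+1 :> nat ->
    stvb_rel [:: S j; S i; T j] [:: T i; S j; S i]
| stvb_st i : stvb_rel [:: S i; T i] [:: T i; S i]
| stvb_gg p q : stvb_rel [:: G p; G q] [:: G q; G p]
| stvb_gr i p : p != strand i -> p != strandS i ->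
    stvb_rel [:: G p; R i] [:: R i; G p]
| stvb_gs i p : p != strand i -> p != strandS i ->
    stvb_rel [:: G p; S i] [:: S i; G p]
| stvb_gt i p : p != strand i -> p != strandS i ->
    stvb_rel [:: G p; T i] [:: T i; G p]
| stvb_grS i : stvb_rel [:: G (strandS i); R i] [:: R i; G (strand i)]
| stvb_rsr_g i : stvb_rel [:: R i; S i; R i]
    [:: G (strandS i); G (strand i); S i; G (strand i); G (strandS i)]
| stvb_rtr_g i : stvb_rel [:: R i; T i; R i]
    [:: G (strandS i); G (strand i); T i; G (strand i); G (strandS i)].

End STVB.

Definition STVB (n : nat) := presented (@stvb_rel n).
HB.instance Definition _ n := monoid.Monoid.on (STVB n).

Definition sigma n (i : 'I_n.-1) : STVB n := pgen (@stvb_rel n) (Sigma i).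
Definition sigmaV n (i : 'I_n.-1) : STVB n := pgen (@stvb_rel n) (SigmaInv i).
Definition rho n (i : 'I_n.-1) : STVB n := pgen (@stvb_rel n) (Rho i).
Definition tau n (i : 'I_n.-1) : STVB n := pgen (@stvb_rel n) (Tau i).
Definition gamma n (j : 'I_n) : STVB n := pgen (@stvb_rel n) (Gamma j).

(* Products in [{perm _}] compose from left to right; as transpositions are
   involutions, the kernel is the same for the other convention. *)
Definition phi2_gen n (a : stvb_gen n) : 'S_n :=
  if a is Rho i then tperm (strand i) (strandS i) else 1.

Lemma tperm_braid (T : finType) (x y z : T) : x != y -> y != z -> x != z ->
  tperm x y * tperm y z * tperm x y = tperm y z * tperm x y * tperm y z.
Proof.
move=> xy yz xz.
have Jt (a b c d : T) :
    tperm a b * tperm c d * tperm a b = tperm (tperm a b c) (tperm a b d).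
  by rewrite -tpermJ /conjg tpermV mulgA.
rewrite !Jt !tpermR tpermL (@tpermD _ x y z) 1?(@tpermD _ y z x) //.
all: by rewrite 1?eq_sym // eq_sym.
Qed.

Lemma phi2_rel n (u v : seq (stvb_gen n)) :
  stvb_rel u v -> weval (@phi2_gen n) u = weval (@phi2_gen n) v.
Proof.
case=> {u v} [i|i|i|p|i j ij|i j ij|i j ij|i j ij|i j ij|i j ij|i j ij|i j ij
  |i j ij|i j ij|i j ij|i j ij|i|p q|i p pi piS|i p pi piS|i p pi piS|i|i|i];
  rewrite /weval !big_cons !big_nil /= ?mulg1 ?mul1g ?tperm2 //.
- apply/commgP/conjg_fixP; rewrite tpermJ.
  by rewrite !tpermD // -val_eqE /=; move: ij; rewrite /far; lia.
- have -> : strand j = strandS i by apply: val_inj.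
  rewrite !mulgA tperm_braid // -val_eqE /=; lia.
Qed.

Definition phi2 n : STVB n -> 'S_n := plift (@phi2_gen n).

Lemma phi2_monoid_morphism n : monoid_morphism (@phi2 n).
Proof. exact: plift_monoid_morphism (@phi2_rel n). Qed.

HB.instance Definition _ n :=
  isUMagmaMorphism.Build (STVB n) 'S_n (@phi2 n) (@phi2_monoid_morphism n).

Lemma phi2_pgen n (a : stvb_gen n) :
  phi2 (pgen (@stvb_rel n) a) = phi2_gen a.
Proof.
by rewrite /phi2 plift_pword ?/weval ?big_seq1 //; exact: phi2_rel.
Qed.

Definition STVH n := kernel (@phi2 n).
HB.instance Definition _ n := monoid.Monoid.on (STVH n).

Section Elements.
Variable n : nat.

Lemma low_proof (k l : 'I_n) : k != l -> (minn k l < n.-1)%N.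
Proof.
move=> kl; have : (k : nat) != l by [].
by have := ltn_ord k; have := ltn_ord l; lia.
Qed.

Definition low (k l : 'I_n) (kl : k != l) : 'I_n.-1 := Ordinal (low_proof kl).

Definition between (i j : nat) : seq 'I_n.-1 :=
  [seq m : 'I_n.-1 <- enum 'I_n.-1 | (i < m < j)%N].

(* For a = sigma, i = min(k, l) and j = max(k, l): the element w a_i w' when
   k < l, and w rho_i a_i rho_i w' when k > l, where
   w = rho_{j-1} ... rho_{i+1} and w' = rho_{i+1} ... rho_{j-1}. *)
Definition spread (a : 'I_n.-1 -> STVB n) (k l : 'I_n) (kl : k != l) : STVB n :=
  let i := low kl in
  let s := between (minn k l) (maxn k l) in
  \prod_(m <- rev s) rho m *
  (if (k < l)%N then a i else rho i * a i * rho i) *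
  \prod_(m <- s) rho m.

Definition x_elt := spread (@sigma n).
Definition xV_elt := spread (@sigmaV n).
Definition z_elt := spread (@tau n).

Lemma rhoK i : rho i * rho i = 1 :> STVB n.
Proof. by rewrite /rho /pgen -pwordM; apply/pword_eq/cong_rel/stvb_rhoK. Qed.

Lemma sigmaK i : sigma i * sigmaV i = 1 :> STVB n.
Proof. by rewrite /sigma /pgen -pwordM; apply/pword_eq/cong_rel/stvb_sigmaK. Qed.

Lemma sigmaVK i : sigmaV i * sigma i = 1 :> STVB n.
Proof. by rewrite /sigma /pgen -pwordM; apply/pword_eq/cong_rel/stvb_sigmaVK. Qed.

Lemma prod_rho_revK (s : seq 'I_n.-1) :
  (\prod_(m <- rev s) rho m) * (\prod_(m <- s) rho m) = 1 :> STVB n.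
Proof.
elim: s => [|m s IHs]; first by rewrite !big_nil mulg1.
rewrite rev_cons -cats1 big_cat big_seq1 big_cons /=.
by rewrite -mulgA (mulgA (rho m)) rhoK mul1g.
Qed.

Lemma spreadM a b c k l (kl : k != l) : (forall i, a i * b i = c i) ->
  spread a kl * spread b kl = spread c kl.
Proof.
move=> abc; rewrite /spread; set s := between _ _; set i := low _.
have sK := prod_rho_revK (rev s); rewrite revK in sK.
rewrite -!mulgA (mulgA (\prod_(m <- s) _)) sK mul1g !mulgA; congr (_ * _).
rewrite -!mulgA; congr (_ * _); case: ifP => _ //.
by rewrite -!mulgA (mulgA (rho i) (rho i)) rhoK mul1g (mulgA (a i)) abc.
Qed.

Lemma spread1 k l (kl : k != l) : spread (fun=> 1) kl = 1.
Proof.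
rewrite /spread; case: ifP => _; rewrite ?mulg1 ?rhoK ?mulg1; exact: prod_rho_revK.
Qed.

Lemma x_eltK k l (kl : k != l) : x_elt kl * xV_elt kl = 1.
Proof. by rewrite -(spread1 kl); apply: spreadM; exact: sigmaK. Qed.

Lemma x_eltVK k l (kl : k != l) : xV_elt kl * x_elt kl = 1.
Proof. by rewrite -(spread1 kl); apply: spreadM; exact: sigmaVK. Qed.

Lemma phi2_spread a k l (kl : k != l) : (forall i, phi2 (a i) = 1) ->
  phi2 (spread a kl) = 1.
Proof.
move=> a1; have -> : phi2 (spread a kl) = phi2 (spread (fun=> 1) kl).
  by rewrite /spread; case: ifP => _; rewrite !gmulfM gmulf1 /= a1.
by rewrite spread1 gmulf1.
Qed.

End Elements.

(* The pairs (k, l) are ordered, and boolean proof irrelevance makes [X kl]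
   depend on k and l only. *)
Inductive stvh_gen (n : nat) : Type :=
| X (k l : 'I_n) of k != l
| XInv (k l : 'I_n) of k != l
| Z (k l : 'I_n) of k != l
| HGamma of 'I_n.

HB.instance Definition _ n := gen_eqMixin (stvh_gen n).
HB.instance Definition _ n := gen_choiceMixin (stvh_gen n).

Section Presentation_STVH.
Variable n : nat.
Implicit Types i j k l : 'I_n.

Definition stvh_val (a : stvh_gen n) : STVB n :=
  match a with
  | X _ _ kl => x_elt kl
  | XInv _ _ kl => xV_elt kl
  | Z _ _ kl => z_elt kl
  | HGamma j => gamma j
  end.

Lemma stvh_val_ker a : stvh_val a \in mon_ker (@phi2 n).
Proof.
rewrite inE; apply/eqP; case: a => [k l kl|k l kl|k l kl|j] /=.
all: try by apply: phi2_spread => i; rewrite phi2_pgen.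
by rewrite phi2_pgen.
Qed.

Definition stvh_elt (a : stvh_gen n) : STVH n :=
  exist (fun x => x \in mon_ker (@phi2 n)) (stvh_val a) (stvh_val_ker a).

Local Notation G := (@HGamma n).

Inductive stvh_rel : seq (stvh_gen n) -> seq (stvh_gen n) -> Prop :=
| stvh_gammaK i : stvh_rel [:: G i; G i] [::]
| stvh_gg i j : stvh_rel [:: G i; G j] [:: G j; G i]
| stvh_xK i j (ij : i != j) : stvh_rel [:: X ij; XInv ij] [::]
| stvh_xVK i j (ij : i != j) : stvh_rel [:: XInv ij; X ij] [::]
| stvh_xx i j k l (ij : i != j) (kl : k != l) : uniq [:: i; j; k; l] ->
    stvh_rel [:: X ij; X kl] [:: X kl; X ij]
| stvh_xxx i j k (ik : i != k) (kj : k != j) : i != j ->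
    stvh_rel [:: X ik; X kj; X ik] [:: X kj; X ik; X kj]
| stvh_xg i j k (ij : i != j) : k != i -> k != j ->
    stvh_rel [:: X ij; G k] [:: G k; X ij]
| stvh_x_g i j (ij : i != j) (ji : j != i) :
    stvh_rel [:: X ij] [:: G i; G j; X ji; G j; G i]
| stvh_xz i j k l (ij : i != j) (kl : k != l) : uniq [:: i; j; k; l] ->
    stvh_rel [:: X ij; Z kl] [:: Z kl; X ij]
| stvh_xxz i j k (ik : i != k) (kj : k != j) : i != j ->
    stvh_rel [:: X ik; X kj; Z ik] [:: Z kj; X ik; X kj]
| stvh_zxx i j k (ik : i != k) (kj : k != j) : i != j ->
    stvh_rel [:: Z ik; X kj; X ik] [:: X kj; X ik; Z kj]
| stvh_xz_same i j (ij : i != j) : stvh_rel [:: X ij; Z ij] [:: Z ij; X ij]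
| stvh_zz i j k l (ij : i != j) (kl : k != l) : uniq [:: i; j; k; l] ->
    stvh_rel [:: Z ij; Z kl] [:: Z kl; Z ij]
| stvh_zg i j k (ij : i != j) : k != i -> k != j ->
    stvh_rel [:: Z ij; G k] [:: G k; Z ij]
| stvh_z_g i j (ij : i != j) (ji : j != i) :
    stvh_rel [:: Z ij] [:: G i; G j; Z ji; G j; G i].

End Presentation_STVH.

(* Main.v *)
(** Reidemeister-Schreier rewriting along phi_2. Reading a word of STVB_n from
    left to right while recording the permutation p of the prefix read so far,
    one replaces sigma_i by x_{kl} with (k, l) = (p^-1 i, p^-1 (i + 1)), does
    likewise for the other letters, and drops the rho_i. Each defining relation of
    STVB_n becomes a relation of the presentation or a trivial identity, so the
    rewriting is invariant under the congruence; it sends a word representing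
    x_{kl} back to x_{kl}, which gives injectivity. In the other direction, a word
    u equals its rewriting times the product of its rho letters. If phi_2 kills u,
    this product of rho's is trivial because the rho_i satisfy the Coxeter
    relations of S_n, which gives surjectivity. The relations of the presentation
    hold in STVB_n because conjugation by rho's permutes the indices of the
    generators, so that it suffices to check them on adjacent strands. *)

Require Import Defs.
From HB Require Import structures.
From mathcomp Require Import all_boot all_fingroup.
From mathcomp Require Import generic_quotient zify.

Set Implicit Arguments.
Unset Strict Implicit.
Unset Printing Implicit Defensive.

Local Open Scope group_scope.

(** * The Coxeter relations of type A *)

Definition nswap (m x : nat) : nat :=
  if x == m then m.+1 else if x == m.+1 then m else x.

Section CoxeterGenerators.
Variables (M : monoidType) (B : nat) (r : nat -> M).
Hypothesis rK : forall m, r m * r m = 1.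
Hypothesis rC : forall i j, (i.+1 < j)%N -> r i * r j = r j * r i.
Hypothesis rB : forall m, (m.+1 < B)%N ->
  r m * r m.+1 * r m = r m.+1 * r m * r m.+1.

Lemma reflKl m x : r m * (r m * x) = x.
Proof. by rewrite mulgA rK mul1g. Qed.

Lemma reflC i j : ((i.+1 < j) || (j.+1 < i))%N -> r i * r j = r j * r i.
Proof. by case/orP=> /rC. Qed.

Definition rword (s : seq nat) : M := \prod_(m <- s) r m.

Lemma rword_cons m s : rword (m :: s) = r m * rword s.
Proof. by rewrite /rword big_cons. Qed.

Lemma rword_cat s t : rword (s ++ t) = rword s * rword t.
Proof. by rewrite /rword big_cat. Qed.

Lemma rword_rcons s m : rword (rcons s m) = rword s * r m.
Proof. by rewrite -cats1 rword_cat /rword big_seq1. Qed.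

Lemma rword_comm m s : all (fun k => (k.+1 < m) || (m.+1 < k))%N s ->
  rword s * r m = r m * rword s.
Proof.
elim: s => [_|k s IHs /= /andP[km ms]]; first by rewrite /rword big_nil mulg1 mul1g.
by rewrite rword_cons -mulgA IHs // !mulgA reflC.
Qed.

(** The word [r (N-1) ... r k]. In the symmetric group on the points [0, ..., N], these words for
    [k <= N] represent the right cosets of the subgroup generated by the letters below [N-1]. *)
Definition descent (N k : nat) : M := rword (rev (iota k (N - k))).

Lemma descentS N k : (k < N)%N -> descent N k = descent N k.+1 * r k.
Proof.
move=> kN; rewrite /descent; have -> : (N - k = (N - k.+1).+1)%N by lia.
by rewrite /= rev_cons rword_rcons.
Qed.

Lemma descentN N : descent N N = 1.
Proof. by rewrite /descent subnn /rword big_nil. Qed.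

Lemma descent_comm N k m : (m.+1 < k)%N -> descent N k * r m = r m * descent N k.
Proof.
move=> mk; apply: rword_comm; rewrite all_rev; apply/allP=> l.
by rewrite mem_iota; lia.
Qed.

(** Moving left, [r m.+1] commutes with the letters below [m], then meets [r m.+1 * r m]. One braid
    move produces [r m] on the left, and this commutes with all letters above [m.+1]. *)
Lemma descent_shift N k m : (N <= B)%N -> (k <= m)%N -> (m.+1 < N)%N ->
  descent N k * r m.+1 = r m * descent N k.
Proof.
move=> NB; move: {2}(m - k)%N (erefl (m - k)%N) => d.
elim: d k => [|d IHd] k dE km mN.
  have -> : k = m by lia.
  rewrite (@descentS N m) 1?(@descentS N m.+1) -?mulgA; try lia.
  rewrite (mulgA (r m.+1)) -rB; last by lia.
  by rewrite !mulgA descent_comm.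
rewrite descentS; last by lia.
by rewrite -mulgA rC ?mulgA ?IHd //; lia.
Qed.

Lemma rword_normal N w : (N <= B)%N -> all (fun m => m < N)%N w ->
  exists u k, [/\ all (fun m => m < N.-1)%N u, (k <= N)%N
    & rword w = rword u * descent N k].
Proof.
move=> NB; elim/last_ind: w => [_|w m IHw].
  by exists [::], N; rewrite descentN mulg1.
rewrite all_rcons => /andP[mN /IHw[u [k [uN kN wE]]]].
rewrite rword_rcons wE -mulgA.
(* A last letter [r m] passes through [descent N k] if [m.+1 < k], lengthens it if [m.+1 = k],
   emerges on the left as [r m.-1] if [m > k], and cancels if [m = k]. *)
have [mk|mk|mE] := ltngtP m k.
- have [mk'|mk'] := ltnP m.+1 k.
    exists (rcons u m), k; rewrite all_rcons uN rword_rcons descent_comm // !mulgA.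
    by split=> //; apply/andP; split=> //; lia.
  have -> : k = m.+1 by lia.
  by exists u, m; split=> //; [exact: ltnW | rewrite (@descentS N m)].
- case: m mN mk => // m mN mk.
  exists (rcons u m), k; rewrite all_rcons uN rword_rcons descent_shift // !mulgA.
  by split=> //; rewrite ltn_predRL mN.
- subst m; exists u, k.+1; split=> //.
  by rewrite descentS // -!mulgA rK mulg1.
Qed.

Section FaithfulAction.
Variable act : M -> nat -> nat.
Hypothesis act1 : forall x, act 1 x = x.
Hypothesis actM : forall a b x, act (a * b) x = act b (act a x).
Hypothesis act_r : forall m x, (m < B)%N -> act (r m) x = nswap m x.

Lemma act_rword_id u x : all (fun m => m < B)%N u -> all (fun m => m.+1 < x)%N u ->
  act (rword u) x = x.
Proof.
elim: u => [|m u IHu] /=; first by rewrite /rword big_nil act1.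
move=> /andP[mB uB] /andP[mx ux].
by rewrite rword_cons actM act_r // /nswap !ifN ?IHu //; lia.
Qed.

Lemma act_descent N k : (k <= N)%N -> (N <= B)%N -> act (descent N k) N = k.
Proof.
move=> kN NB; move: {2}(N - k)%N (erefl (N - k)%N) => d.
elim: d k kN => [|d IHd] k kN dE.
  by have -> : k = N; [lia|rewrite descentN act1].
rewrite descentS ?actM ?IHd ?act_r /nswap; try lia.
by rewrite ifN ?eqxx //; lia.
Qed.

(* The point N is fixed by the letters of u, which forces the factor
   [descent N k] of the normal form to be trivial. *)
Lemma coxeter_faithful w : all (fun m => m < B)%N w ->
  (forall x, act (rword w) x = x) -> rword w = 1.
Proof.
move=> wB w1; move: {1 2}B wB (leqnn B) => N.
elim: N w w1 => [|N IHN] w w1 wN NB.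
  by case: w wN {w1} => [|//]; rewrite /rword big_nil.
have [u [k [uN kN wE]]] := rword_normal NB wN.
have uB : all (fun m => m < B)%N u by apply: sub_all uN => m /=; lia.
have := w1 N.+1; rewrite wE actM act_rword_id ?act_descent // => kE.
rewrite kE descentN mulg1; apply: IHN => [x|//|]; last exact: ltnW.
by have := w1 x; rewrite wE kE descentN mulg1.
Qed.

End FaithfulAction.

(** * Conjugation by the generators *)

Definition cj m x := r m * x * r m.

Lemma cjK m : involutive (cj m).
Proof. by move=> x; rewrite /cj -!mulgA rK mulg1 reflKl. Qed.

Lemma cjC i j x : ((i.+1 < j) || (j.+1 < i))%N -> cj i (cj j x) = cj j (cj i x).
Proof. by move=> ij; rewrite /cj -!mulgA (reflC ij) !mulgA (reflC ij). Qed.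

Lemma cjB m x : (m.+1 < B)%N ->
  cj m (cj m.+1 (cj m x)) = cj m.+1 (cj m (cj m.+1 x)).
Proof.
move=> mB; rewrite /cj.
transitivity ((r m * r m.+1 * r m) * x * (r m * r m.+1 * r m)).
  by rewrite !mulgA.
by rewrite rB // !mulgA.
Qed.

Section Spread.
Variable b : nat -> M.
Hypothesis bC : forall m i, ((i.+1 < m) || (m.+1 < i))%N -> cj m (b i) = b i.
Hypothesis bB : forall i, (i.+1 < B)%N -> cj i (b i.+1) = cj i.+1 (b i).

Definition nspread i j :=
  rword (rev (iota i.+1 (j - i.+1))) * b i * rword (iota i.+1 (j - i.+1)).

Lemma nspread_base i : nspread i i.+1 = b i.
Proof. by rewrite /nspread subnn /rword !big_nil mul1g mulg1. Qed.

Lemma nspreadS i j : (i < j)%N -> nspread i j.+1 = cj j (nspread i j).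
Proof.
move=> ij; rewrite /nspread; have -> : (j.+1 - i.+1 = (j - i.+1).+1)%N by lia.
have iotaE : iota i.+1 (j - i.+1).+1 = rcons (iota i.+1 (j - i.+1)) j.
  by rewrite -(addn1 (j - _)) iotaD cats1; congr rcons; lia.
by rewrite iotaE rev_rcons rword_cons rword_rcons /cj !mulgA.
Qed.

(** Induction on [j], peeling off the outermost conjugation. The excluded pair [(m, m.+1)] is the
    only one whose order is reversed by the swap. *)
Lemma cj_nspread m i j : (i < j)%N -> (j <= B)%N -> (m < B)%N ->
  ~~ ((m == i) && (j == i.+1)) ->
  cj m (nspread i j) = nspread (nswap m i) (nswap m j).
Proof.
have [d dj] := ubnP j; elim: d m j dj => // d IHd m [//|j] jd ij jB mB mij.
have sE x : x != m -> x != m.+1 -> nswap m x = x.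
  by move=> xm xS; rewrite /nswap !ifN.
have sL : nswap m m = m.+1 by rewrite /nswap eqxx.
have sR : nswap m m.+1 = m by rewrite /nswap ifN ?eqxx //; lia.
have [{}ij|ji] := ltnP i j; last first.
  have {ij ji} jE : j = i by lia.
  subst j; rewrite nspread_base.
  have [mE|mi] := eqVneq m i.+1.
    by rewrite -mE sL sE ?mE ?(@nspreadS i i.+1) ?nspread_base //; lia.
  have [iE|mi'] := eqVneq i m.+1.
    by rewrite iE sR sE ?(@nspreadS m m.+1) ?nspread_base ?bB //; lia.
  by rewrite bC ?sE ?nspread_base //; lia.
rewrite nspreadS //.
have [mj|mj] := eqVneq m j.
  by rewrite mj cjK -mj sR sE //; lia.
have [{}mj|mj'] := eqVneq m j.+1.
  by rewrite -mj sL sE ?mj ?(@nspreadS i j.+1) ?(@nspreadS i j) //; lia.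
(* Unless [j = m.+1], [cj m] commutes with the outer [cj j] and the induction hypothesis applies. *)
have [jE|mj''] := eqVneq j m.+1; last first.
  have imj : (nswap m i < j)%N by rewrite /nswap; do 2?case: eqP; lia.
  rewrite cjC; last by lia.
  by rewrite IHd ?(@sE j) ?(@sE j.+1) ?nspreadS //; lia.
subst j; rewrite (@sE m.+2); try lia.
have [iE|im] := eqVneq i m.
  by rewrite iE sL !nspread_base -bB ?cjK //; lia.
rewrite sE; try lia.
rewrite !nspreadS; try lia.
rewrite cjB; last by lia.
(* After the braid move the inner [cj m.+1] acts on [nspread i m], whose indices lie below
   [m.+1]. *)
congr (cj _ (cj _ _)); rewrite IHd; try lia.
by rewrite /nswap !ifN //; lia.
Qed.

End Spread.

(** Together with [cj_braid]: the family [cj i (b i)] inherits the two hypotheses on [b], so that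
    [cj_nspread] also covers the elements whose first index is the larger one. *)
Lemma cj_comm b m i : (forall m i, ((i.+1 < m) || (m.+1 < i))%N -> cj m (b i) = b i) ->
  ((i.+1 < m) || (m.+1 < i))%N -> cj m (cj i (b i)) = cj i (b i).
Proof.
move=> bC mi; have im : ((m.+1 < i) || (i.+1 < m))%N by rewrite orbC.
by rewrite cjC // bC.
Qed.

Lemma cj_braid b i : (forall i, (i.+1 < B)%N -> cj i (b i.+1) = cj i.+1 (b i)) ->
  (i.+1 < B)%N -> cj i (cj i.+1 (b i.+1)) = cj i.+1 (cj i (b i)).
Proof.
by move=> bB iB; rewrite -[b i.+1](cjK i) bB // cjB // cjK.
Qed.

End CoxeterGenerators.

(** * Conjugation by the rho's *)

Section RhoConjugation.
Variable n : nat.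
Implicit Types (i j : 'I_n.-1) (k l : 'I_n).

Lemma stvb_relE u v : stvb_rel u v ->
  \prod_(a <- u) pgen (@stvb_rel n) a = \prod_(a <- v) pgen (@stvb_rel n) a.
Proof.
have pE w : \prod_(a <- w) pgen (@stvb_rel n) a = pword (@stvb_rel n) w.
  by elim: w => [|a w IHw]; rewrite ?big_nil // big_cons IHw -pwordM.
by move=> uv; rewrite !pE; exact/pword_eq/cong_rel.
Qed.

Lemma stvb_rel2E a b c d : stvb_rel [:: a; b] [:: c; d] ->
  pgen (@stvb_rel n) a * pgen (@stvb_rel n) b =
  pgen (@stvb_rel n) c * pgen (@stvb_rel n) d.
Proof. by move/stvb_relE; rewrite !big_cons !big_nil !mulg1. Qed.

Lemma stvb_rel3E a b c d e f : stvb_rel [:: a; b; c] [:: d; e; f] ->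
  pgen (@stvb_rel n) a * pgen (@stvb_rel n) b * pgen (@stvb_rel n) c =
  pgen (@stvb_rel n) d * pgen (@stvb_rel n) e * pgen (@stvb_rel n) f.
Proof. by move/stvb_relE; rewrite !big_cons !big_nil !mulg1 !mulgA. Qed.

(** The default value 1 keeps the involution and commutation laws of the rho's valid on all of
    [nat]. The braid law fails across the boundary, whence the bound [B] on it above. *)
Definition nat_ext (a : 'I_n.-1 -> STVB n) (m : nat) : STVB n :=
  if insub m is Some i then a i else 1.

Lemma nat_extE a i : nat_ext a i = a i.
Proof. by rewrite /nat_ext valK. Qed.

Lemma nat_ext_out a m : (n.-1 <= m)%N -> nat_ext a m = 1.
Proof. by move=> nm; rewrite /nat_ext insubF // ltnNge nm. Qed.

Variant nat_ext_spec (m : nat) : Type :=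
| NatExtIn i of m = i
| NatExtOut of (n.-1 <= m)%N.

Lemma nat_extP m : nat_ext_spec m.
Proof.
have [lt|ge] := ltnP m n.-1; last exact: NatExtOut.
by apply: (@NatExtIn m (Ordinal lt)).
Qed.

Local Notation rn := (nat_ext (@rho n)).

Lemma nrhoK m : rn m * rn m = 1.
Proof.
case: (nat_extP m) => [i ->|nm]; first by rewrite !nat_extE rhoK.
by rewrite nat_ext_out // mulg1.
Qed.

Lemma nat_ext_comm a b : (forall i j, far i j -> a i * b j = b j * a i) ->
  forall i j : nat, ((i.+1 < j) || (j.+1 < i))%N ->
  nat_ext a i * nat_ext b j = nat_ext b j * nat_ext a i.
Proof.
move=> ab i j.
case: (nat_extP i) => [i' ->|ni] ij; last by rewrite nat_ext_out // mulg1 mul1g.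
move: ij; case: (nat_extP j) => [j' ->|nj] ij; last first.
  by rewrite (nat_ext_out _ nj) mulg1 mul1g.
by rewrite !nat_extE ab.
Qed.

Lemma nrhoC (i j : nat) : (i.+1 < j)%N -> rn i * rn j = rn j * rn i.
Proof.
move=> ij; apply: nat_ext_comm; last by rewrite ij.
by move=> i' j' f; apply/stvb_rel2E/stvb_far_rr.
Qed.

Lemma nat_ext_S m : (m.+1 < n.-1)%N ->
  exists i j, [/\ j = i.+1 :> nat, m = i & m.+1 = j].
Proof. by move=> mn; exists (Ordinal (ltnW mn)), (Ordinal mn). Qed.

Lemma nrhoB m : (m.+1 < n.-1)%N -> rn m * rn m.+1 * rn m = rn m.+1 * rn m * rn m.+1.
Proof.
case/nat_ext_S=> i [j [ij -> ->]]; rewrite !nat_extE.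
exact/stvb_rel3E/stvb_rrr.
Qed.

Lemma prod_rho s : \prod_(m <- s) rho m = rword rn (map (@nat_of_ord _) s).
Proof. by rewrite /rword big_map; apply: eq_bigr => i _; rewrite nat_extE. Qed.

Lemma val_between (i j : nat) : (j <= n.-1)%N ->
  map (@nat_of_ord _) (between n i j) = iota i.+1 (j - i.+1).
Proof.
move=> jn; rewrite /between -(filter_map (@nat_of_ord _) (fun m => i < m < j)%N).
rewrite val_enum_ord.
apply: (irr_sorted_eq ltn_trans ltnn) => [||m].
- by apply: sorted_filter (iota_ltn_sorted _ _); exact: ltn_trans.
- exact: iota_ltn_sorted.
by rewrite mem_filter !mem_iota; lia.
Qed.

(* The middle factor of [spread a] at (k, l): b is the truth value of k < l. *)
Definition signed_ext (a : 'I_n.-1 -> STVB n) (b : bool) (m : nat) : STVB n :=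
  if b then nat_ext a m else cj rn m (nat_ext a m).

Lemma spreadE a k l (kl : k != l) :
  spread a kl = nspread rn (signed_ext a (k < l)%N) (minn k l) (maxn k l).
Proof.
have kl' : (k : nat) != l by [].
have ltm : (minn k l < n.-1)%N by exact: low_proof.
rewrite /spread !prod_rho map_rev val_between; last first.
  by have := ltn_ord k; have := ltn_ord l; lia.
rewrite /nspread /signed_ext; congr (_ * _ * _).
have -> : minn k l = low kl by [].
by case: ifP => _; rewrite ?/cj !nat_extE.
Qed.

Lemma tperm_strand i k : tperm (strand i) (strandS i) k = nswap i k :> nat.
Proof.
rewrite /nswap; case: tpermP => [->|->|] /=; rewrite ?eqxx //.
  by rewrite ifN ?eqxx //; lia.
by move=> /eqP; rewrite -val_eqE => /= /negPf -> /eqP; rewrite -val_eqE => /= /negPf ->.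
Qed.

Section Family.
Variable a : 'I_n.-1 -> STVB n.
Hypothesis aC : forall i j, far i j -> a i * rho j = rho j * a i.
Hypothesis aB : forall i j, j = i.+1 :> nat ->
  rho i * a j * rho i = rho j * a i * rho j.

Lemma signed_extC b (m i : nat) : ((i.+1 < m) || (m.+1 < i))%N ->
  cj rn m (signed_ext a b i) = signed_ext a b i.
Proof.
have C (m' i' : nat) : ((i'.+1 < m') || (m'.+1 < i'))%N ->
    cj rn m' (nat_ext a i') = nat_ext a i'.
  by move=> mi; rewrite /cj -mulgA (nat_ext_comm aC mi) mulgA nrhoK mul1g.
rewrite /signed_ext; case: b => mi; first exact: C.
exact: (cj_comm nrhoC).
Qed.

Lemma signed_extB b m : (m.+1 < n.-1)%N ->
  cj rn m (signed_ext a b m.+1) = cj rn m.+1 (signed_ext a b m).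
Proof.
have E m' : (m'.+1 < n.-1)%N ->
    cj rn m' (nat_ext a m'.+1) = cj rn m'.+1 (nat_ext a m').
  by case/nat_ext_S=> i [j [ij -> ->]]; rewrite /cj !nat_extE aB.
rewrite /signed_ext; case: b => mn; first exact: E.
exact: (cj_braid nrhoK nrhoB).
Qed.

Lemma rho_spread i k l (kl : k != l) k' l' (kl' : k' != l') :
    k' = tperm (strand i) (strandS i) k -> l' = tperm (strand i) (strandS i) l ->
  rho i * spread a kl = spread a kl' * rho i.
Proof.
move=> kE lE.
suff E : cj rn i (spread a kl) = spread a kl'.
  by rewrite -E /cj nat_extE -(mulgA _ (rho i)) rhoK mulg1.
have nK : (k' = nswap i k :> nat)%N by rewrite kE tperm_strand.
have nL : (l' = nswap i l :> nat)%N by rewrite lE tperm_strand.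
have klN : (k : nat) != l by []; have kn := ltn_ord k; have ln := ltn_ord l.
have iN := ltn_ord i; rewrite !spreadE nK nL.
(* If [k] and [l] are the two swapped strands, their order is reversed, and [cj] exchanges the two
   signed families. *)
have [/andP[/eqP kI /eqP lI]|N1] := boolP ((k == i :> nat) && (l == i.+1 :> nat)).
  rewrite kI lI /nswap eqxx ifN ?eqxx; last by lia.
  rewrite (minn_idPl (leqnSn i)) (maxn_idPr (leqnSn i)).
  rewrite (minn_idPr (leqnSn i)) (maxn_idPl (leqnSn i)) !nspread_base.
  by rewrite /signed_ext ltnSn ltnNge leqnSn.
have [/andP[/eqP kI /eqP lI]|N2] := boolP ((l == i :> nat) && (k == i.+1 :> nat)).
  rewrite kI lI /nswap eqxx ifN ?eqxx; last by lia.
  rewrite (minn_idPl (leqnSn i)) (maxn_idPr (leqnSn i)).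
  rewrite (minn_idPr (leqnSn i)) (maxn_idPl (leqnSn i)) !nspread_base.
  by rewrite /signed_ext ltnSn ltnNge leqnSn /= cjK //; exact: nrhoK.
(* In all other cases the swap preserves the order of [k] and [l], so it commutes with [minn] and
   [maxn]. *)
have -> : (nswap i k < nswap i l)%N = (k < l)%N.
  by rewrite /nswap; do 6?case: eqP; lia.
have -> : minn (nswap i k) (nswap i l) = nswap i (minn k l).
  by rewrite /nswap; do 6?case: eqP; lia.
have -> : maxn (nswap i k) (nswap i l) = nswap i (maxn k l).
  by rewrite /nswap; do 6?case: eqP; lia.
apply: (cj_nspread nrhoK nrhoC nrhoB (@signed_extC _) (@signed_extB _)); lia.
Qed.

End Family.

End RhoConjugation.

(** * Permuting the indices of the generators *)

Lemma perm_map_uniq (T : finType) (s t : seq T) :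
  uniq s -> uniq t -> size s = size t -> exists p : {perm T}, map p s = t.
Proof.
elim: s t => [|x s IHs] [|y t] //=; first by exists 1.
case/andP=> xs us /andP[yt ut] [/(IHs _ us ut)[p pst]].
(* [p] already matches the tails; the transposition corrects the head and moves no entry of the tail
   [t]. *)
exists (p * tperm (p x) y); rewrite permM tpermL; congr (_ :: _).
rewrite -[RHS]pst; apply/eq_in_map => z zs; rewrite permM tpermD //.
  by apply: contraNneq xs => /perm_inj ->.
by apply: contraNneq yt => ->; rewrite -pst map_f.
Qed.

Section PermutationAction.
Variable n : nat.
Implicit Types (i j : 'I_n.-1) (k l : 'I_n) (p s : 'S_n).

Definition adj i : 'S_n := tperm (strand i) (strandS i).

Lemma strand_neq i : strand i != strandS i.
Proof. by rewrite -val_eqE /=; lia. Qed.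

Lemma adj_generate s : exists u : seq 'I_n.-1, s = \prod_(i <- u) adj i.
Proof.
pose Q s := exists u : seq 'I_n.-1, s = \prod_(i <- u) adj i.
have Q1 : Q 1 by exists [::]; rewrite big_nil.
have QM s1 s2 : Q s1 -> Q s2 -> Q (s1 * s2).
  by move=> [u ->] [v ->]; exists (u ++ v); rewrite big_cat.
have Qadj i : Q (adj i) by exists [:: i]; rewrite big_seq1.
have Qlt d k l : (l = k + d.+1 :> nat)%N -> Q (tperm k l).
  elim: d l => [|d IHd] l lE.
    have kn : (k < n.-1)%N by have := ltn_ord l; lia.
    have -> : tperm k l = adj (Ordinal kn) by congr tperm; apply: val_inj => /=; lia.
    exact: Qadj.
  have ln : (l.-1 < n.-1)%N by have := ltn_ord l; lia.
  pose i : 'I_n.-1 := Ordinal ln.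
  (* With [i = l - 1], the transposition of [k] and [l] is the conjugate by [adj i] of that of [k]
     and [l - 1], which shortens the distance by one. *)
  have -> : tperm k l = adj i * tperm k (strand i) * adj i.
    have lS : l = strandS i by apply: val_inj => /=; lia.
    have -> : adj i * tperm k (strand i) * adj i = tperm k (strand i) ^ adj i.
      by rewrite conjgE tpermV mulgA.
    by rewrite tpermJ tpermL tpermD -?lS // -val_eqE /=; lia.
  apply: (QM _ _ (QM _ _ _ _)) => //; apply: IHd => /=; lia.
have [ts -> _] := prod_tpermP s.
elim: ts => [|[k l] ts IHts]; rewrite ?big_nil // big_cons; apply: (QM) => //=.
have [kl|lk|kl] := ltngtP k l.
- by apply: (Qlt (l - k).-1); lia.
- by rewrite tpermC; apply: (Qlt (k - l).-1); lia.
- by rewrite (val_inj kl) tperm1.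
Qed.

Lemma perm_neq s k l : k != l -> s k != s l.
Proof. by rewrite (inj_eq perm_inj). Qed.

Definition gperm s (b : stvh_gen n) : stvh_gen n :=
  match b with
  | X _ _ kl => X (perm_neq s kl)
  | XInv _ _ kl => XInv (perm_neq s kl)
  | Z _ _ kl => Z (perm_neq s kl)
  | HGamma k => HGamma (s k)
  end.

Lemma eq_X k l k' l' (kl : k != l) (kl' : k' != l') :
  k = k' -> l = l' -> X kl = X kl'.
Proof. by move=> kk ll; subst k' l'; congr X; exact: bool_irrelevance. Qed.

Lemma eq_XInv k l k' l' (kl : k != l) (kl' : k' != l') :
  k = k' -> l = l' -> XInv kl = XInv kl'.
Proof. by move=> kk ll; subst k' l'; congr XInv; exact: bool_irrelevance. Qed.

Lemma eq_Z k l k' l' (kl : k != l) (kl' : k' != l') :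
  k = k' -> l = l' -> Z kl = Z kl'.
Proof. by move=> kk ll; subst k' l'; congr Z; exact: bool_irrelevance. Qed.

Lemma gperm1 b : gperm 1 b = b.
Proof.
case: b => [k l kl|k l kl|k l kl|k] /=; last by rewrite perm1.
- by apply: eq_X; rewrite perm1.
- by apply: eq_XInv; rewrite perm1.
- by apply: eq_Z; rewrite perm1.
Qed.

Lemma gpermM s p b : gperm (s * p) b = gperm p (gperm s b).
Proof.
case: b => [k l kl|k l kl|k l kl|k] /=; last by rewrite permM.
- by apply: eq_X; rewrite permM.
- by apply: eq_XInv; rewrite permM.
- by apply: eq_Z; rewrite permM.
Qed.

Lemma rho_x k l (kl : k != l) i (kl' : adj i k != adj i l) :
  rho i * x_elt kl = x_elt kl' * rho i.
Proof.
apply: rho_spread => // {k l kl kl'} i j ij.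
  exact/stvb_rel2E/stvb_far_sr.
exact/stvb_rel3E/stvb_rsr.
Qed.

Lemma rho_z k l (kl : k != l) i (kl' : adj i k != adj i l) :
  rho i * z_elt kl = z_elt kl' * rho i.
Proof.
apply: rho_spread => // {k l kl kl'} i j ij.
  exact/stvb_rel2E/stvb_far_tr.
exact/stvb_rel3E/stvb_rtr.
Qed.

(** The defining relations tie the rho's to the sigma's only; the rule for the inverses follows from
    [rho_x] by cancellation. *)
Lemma rho_xV k l (kl : k != l) i (kl' : adj i k != adj i l) :
  rho i * xV_elt kl = xV_elt kl' * rho i.
Proof.
rewrite -[LHS]mul1g -(x_eltVK kl') -mulgA [x_elt kl' * _]mulgA -rho_x.
by rewrite -[rho i * _ * _]mulgA x_eltK mulg1.
Qed.

Lemma rho_gamma k i : rho i * gamma k = gamma (adj i k) * rho i.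
Proof.
have S : gamma (strandS i) * rho i = rho i * gamma (strand i).
  exact/stvb_rel2E/stvb_grS.
rewrite /adj; case: tpermP => [->|->|ki kiS]; first by rewrite S.
  (* The defining relation treats the lower strand; multiplying it by [rho i] on both sides treats
     the upper one. *)
  transitivity (rho i * (gamma (strandS i) * rho i) * rho i).
    by rewrite -!mulgA rhoK mulg1.
  by rewrite S mulgA rhoK mul1g.
by apply/esym/stvb_rel2E/stvb_gr; apply/eqP.
Qed.

Lemma rho_val b i : rho i * stvh_val b = stvh_val (gperm (adj i) b) * rho i.
Proof.
case: b => [k l kl|k l kl|k l kl|k] /=.
- exact: rho_x.
- exact: rho_xV.
- exact: rho_z.
- exact: rho_gamma.
Qed.

Lemma rho_weval v i : rho i * weval (@stvh_val n) v =
  weval (@stvh_val n) (map (gperm (adj i)) v) * rho i.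
Proof.
rewrite /weval; elim: v => [|b v IHv]; first by rewrite !big_nil mulg1 mul1g.
by rewrite /= !big_cons mulgA rho_val -mulgA IHv mulgA.
Qed.

(** Conjugating an identity by [rho i] applies [adj i] to all its indices, and the [adj i] generate
    $S_n$. Hence a relation need only be checked for one choice of indices in each orbit. *)
Lemma weval_gperm s u v :
  weval (@stvh_val n) u = weval (@stvh_val n) v ->
  weval (@stvh_val n) (map (gperm s) u) = weval (@stvh_val n) (map (gperm s) v).
Proof.
have id1 w : map (gperm 1) w = w.
  by rewrite -[RHS]map_id; apply: eq_map; exact: gperm1.
have [r ->] := adj_generate s; elim: r u v => [|i r IHr] u v uv.
  by rewrite big_nil !id1.
have mE w : map (gperm (adj i * \prod_(j <- r) adj j)) w =
    map (gperm (\prod_(j <- r) adj j)) (map (gperm (adj i)) w).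
  by rewrite -map_comp; apply: eq_map => b /=; rewrite gpermM.
rewrite big_cons !mE; apply: IHr.
have := congr1 (fun q => rho i * q * rho i) uv.
by rewrite !rho_weval -!(mulgA _ (rho i) (rho i)) rhoK !mulg1.
Qed.

Lemma uniq_size_ord (t : seq 'I_n) : uniq t -> (size t <= n)%N.
Proof. by move/card_uniqP <-; rewrite -[X in (_ <= X)%N]card_ord max_card. Qed.

(** Here and in the next two lemmas, transitivity on tuples of distinct indices reduces to the first
    strands; the existence of that many indices makes [n] large enough. *)
Lemma perm_std2 k l : k != l -> exists i s, s (strand i) = k /\ s (strandS i) = l.
Proof.
move=> kl; have ukl : uniq [:: k; l] by rewrite /= inE kl.
have i0 : (0 < n.-1)%N by have := uniq_size_ord ukl => /=; lia.
pose i : 'I_n.-1 := Ordinal i0.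
have ust : uniq [:: strand i; strandS i] by [].
have [s [sk sl]] := perm_map_uniq ust ukl erefl.
by exists i, s.
Qed.

Lemma perm_std3 k l m : uniq [:: k; l; m] -> exists i j s,
  [/\ j = i.+1 :> nat, s (strand i) = k, s (strandS i) = l & s (strandS j) = m].
Proof.
move=> uklm; have i1 : (1 < n.-1)%N by have := uniq_size_ord uklm => /=; lia.
pose i : 'I_n.-1 := Ordinal (ltnW i1); pose j : 'I_n.-1 := Ordinal i1.
have ust : uniq [:: strand i; strandS i; strandS j] by [].
have [s [sk sl sm]] := perm_map_uniq ust uklm erefl.
by exists i, j, s.
Qed.

Lemma perm_std4 k l k' l' : uniq [:: k; l; k'; l'] -> exists i j s,
  far i j /\ [/\ s (strand i) = k, s (strandS i) = l,
    s (strand j) = k' & s (strandS j) = l'].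
Proof.
move=> ukl; have i2 : (2 < n.-1)%N by have := uniq_size_ord ukl => /=; lia.
have i0 : (0 < n.-1)%N by lia.
pose i : 'I_n.-1 := Ordinal i0; pose j : 'I_n.-1 := Ordinal i2.
have ust : uniq [:: strand i; strandS i; strand j; strandS j] by [].
have [s [sk sl sk' sl']] := perm_map_uniq ust ukl erefl.
by exists i, j, s.
Qed.

Lemma spread_strand a i (h : strand i != strandS i) : spread a h = a i.
Proof.
rewrite spreadE /= (minn_idPl (leqnSn i)) (maxn_idPr (leqnSn i)) nspread_base.
by rewrite /signed_ext ltnSn nat_extE.
Qed.

Lemma weval_transport s u v u' v' : u = map (gperm s) u' -> v = map (gperm s) v' ->
  weval (@stvh_val n) u' = weval (@stvh_val n) v' ->
  weval (@stvh_val n) u = weval (@stvh_val n) v.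
Proof. by move=> -> ->; exact: weval_gperm. Qed.

End PermutationAction.

(** * Validity of the relations in $STVB_n$ *)

Ltac eq_words := do ?congr (_ :: _);
  solve [reflexivity | apply: eq_X; congruence | apply: eq_Z; congruence].

Section Presentation.
Variable n : nat.
Implicit Types (i j : 'I_n.-1) (k l : 'I_n) (p s : 'S_n).

Local Notation val_word := (weval (@stvh_val n)).

Lemma spread_strandS a i (h : strandS i != strand i) :
  spread a h = rho i * a i * rho i.
Proof.
rewrite spreadE /= (minn_idPr (leqnSn i)) (maxn_idPl (leqnSn i)) nspread_base.
by rewrite /signed_ext ltnNge leqnSn /= /cj !nat_extE.
Qed.

Ltac val_words := rewrite /weval !big_cons !big_nil !mulg1 /=
  /x_elt /z_elt ?spread_strandS ?spread_strand ?mulgA.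

Lemma stvh_rel_val u v : stvh_rel u v -> val_word u = val_word v.
Proof.
case=> {u v} [i|i j|i j ij|i j ij|i j k l ij kl u|i j k ik kj ij|i j k ij ki kj
  |i j ij ji|i j k l ij kl u|i j k ik kj ij|i j k ik kj ij|i j ij|i j k l ij kl u
  |i j k ij ki kj|i j ij ji].
- rewrite /weval !big_cons !big_nil mulg1.
  by have /stvb_relE := stvb_gammaK i; rewrite !big_cons !big_nil mulg1.
- rewrite /weval !big_cons !big_nil !mulg1; exact/stvb_rel2E/stvb_gg.
- by rewrite /weval !big_cons !big_nil !mulg1 x_eltK.
- by rewrite /weval !big_cons !big_nil !mulg1 x_eltVK.
- have [a [b [s [ab [iE jE kE lE]]]]] := perm_std4 u; subst i j k l.
  apply: (@weval_transport _ s _ _ [:: X (strand_neq a); X (strand_neq b)]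
    [:: X (strand_neq b); X (strand_neq a)]); [eq_words | eq_words | val_words].
  exact/stvb_rel2E/stvb_far_ss.
- have [|a [b [s [ba iE kE jE]]]] := @perm_std3 _ i k j.
    by rewrite /= !inE negb_or ik ij kj.
  (* The shared index [k] comes from the upper strand of [a], which is the lower strand of [b]. *)
  subst i j k; have aS : strandS a = strand b by apply: val_inj; rewrite /= ba.
  apply: (@weval_transport _ s _ _
    [:: X (strand_neq a); X (strand_neq b); X (strand_neq a)]
    [:: X (strand_neq b); X (strand_neq a); X (strand_neq b)]);
    [eq_words | eq_words | val_words].
  exact/stvb_rel3E/stvb_sss.
- have [|a [b [s [ba iE jE kE]]]] := @perm_std3 _ i j k.
    by rewrite /= !inE negb_or ij ![_ == k]eq_sym ki kj.
  subst i j k.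
  apply: (@weval_transport _ s _ _ [:: X (strand_neq a); HGamma (strandS b)]
    [:: HGamma (strandS b); X (strand_neq a)]); [eq_words | eq_words | val_words].
  by apply/esym/stvb_rel2E/stvb_gs; rewrite -val_eqE /= ba; lia.
(* The pair is standardized as [(j, i)], since the relation of $STVB_n$ expresses
   $x_{a+1,a}=\rho_a\sigma_a\rho_a$ through $x_{a,a+1}$. *)
- have [a [s [jE iE]]] := perm_std2 ji; subst i j.
  have h : strandS a != strand a by rewrite eq_sym strand_neq.
  apply: (@weval_transport _ s _ _ [:: X h] [:: HGamma (strandS a);
    HGamma (strand a); X (strand_neq a); HGamma (strand a); HGamma (strandS a)]);
    [eq_words | eq_words | val_words].
  have /stvb_relE := stvb_rsr_g a.
  by rewrite !big_cons !big_nil !mulg1 !mulgA.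
- have [a [b [s [ab [iE jE kE lE]]]]] := perm_std4 u; subst i j k l.
  apply: (@weval_transport _ s _ _ [:: X (strand_neq a); Z (strand_neq b)]
    [:: Z (strand_neq b); X (strand_neq a)]); [eq_words | eq_words | val_words].
  exact/stvb_rel2E/stvb_far_st.
- have [|a [b [s [ba iE kE jE]]]] := @perm_std3 _ i k j.
    by rewrite /= !inE negb_or ik ij kj.
  subst i j k; have aS : strandS a = strand b by apply: val_inj; rewrite /= ba.
  apply: (@weval_transport _ s _ _
    [:: X (strand_neq a); X (strand_neq b); Z (strand_neq a)]
    [:: Z (strand_neq b); X (strand_neq a); X (strand_neq b)]);
    [eq_words | eq_words | val_words].
  exact/stvb_rel3E/stvb_sst.
- have [|a [b [s [ba iE kE jE]]]] := @perm_std3 _ i k j.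
    by rewrite /= !inE negb_or ik ij kj.
  subst i j k; have aS : strandS a = strand b by apply: val_inj; rewrite /= ba.
  apply: (@weval_transport _ s _ _
    [:: Z (strand_neq a); X (strand_neq b); X (strand_neq a)]
    [:: X (strand_neq b); X (strand_neq a); Z (strand_neq b)]);
    [eq_words | eq_words | val_words].
  exact/esym/stvb_rel3E/stvb_sst'.
- have [a [s [iE jE]]] := perm_std2 ij; subst i j.
  apply: (@weval_transport _ s _ _ [:: X (strand_neq a); Z (strand_neq a)]
    [:: Z (strand_neq a); X (strand_neq a)]); [eq_words | eq_words | val_words].
  exact/stvb_rel2E/stvb_st.
- have [a [b [s [ab [iE jE kE lE]]]]] := perm_std4 u; subst i j k l.
  apply: (@weval_transport _ s _ _ [:: Z (strand_neq a); Z (strand_neq b)]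
    [:: Z (strand_neq b); Z (strand_neq a)]); [eq_words | eq_words | val_words].
  exact/stvb_rel2E/stvb_far_tt.
- have [|a [b [s [ba iE jE kE]]]] := @perm_std3 _ i j k.
    by rewrite /= !inE negb_or ij ![_ == k]eq_sym ki kj.
  subst i j k.
  apply: (@weval_transport _ s _ _ [:: Z (strand_neq a); HGamma (strandS b)]
    [:: HGamma (strandS b); Z (strand_neq a)]); [eq_words | eq_words | val_words].
  by apply/esym/stvb_rel2E/stvb_gt; rewrite -val_eqE /= ba; lia.
- have [a [s [jE iE]]] := perm_std2 ji; subst i j.
  have h : strandS a != strand a by rewrite eq_sym strand_neq.
  apply: (@weval_transport _ s _ _ [:: Z h] [:: HGamma (strandS a);
    HGamma (strand a); Z (strand_neq a); HGamma (strand a); HGamma (strandS a)]);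
    [eq_words | eq_words | val_words].
  have /stvb_relE := stvb_rtr_g a.
  by rewrite !big_cons !big_nil !mulg1 !mulgA.
Qed.

End Presentation.

(** * Rewriting *)

Section Rewriting.
Variable n : nat.
Implicit Types (i j : 'I_n.-1) (k l : 'I_n) (p s : 'S_n).
Implicit Types (u v : seq (stvb_gen n)).

Local Notation val_word := (weval (@stvh_val n)).
Local Notation pw := (pword (@stvb_rel n)).

Definition pure_letter (a : stvb_gen n) : seq (stvh_gen n) :=
  match a with
  | Sigma i => [:: X (strand_neq i)]
  | SigmaInv i => [:: XInv (strand_neq i)]
  | Rho _ => [::]
  | Tau i => [:: Z (strand_neq i)]
  | Gamma k => [:: HGamma k]
  end.

Fixpoint rewriting p u : seq (stvh_gen n) :=
  if u is a :: u' then
    map (gperm p^-1) (pure_letter a) ++ rewriting (p * phi2_gen a) u'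
  else [::].

Lemma rewriting_cat p u v :
  rewriting p (u ++ v) = rewriting p u ++ rewriting (p * weval (@phi2_gen n) u) v.
Proof.
elim: u p => [|a u IHu] p /=; first by rewrite /weval big_nil mulg1.
by rewrite IHu /weval big_cons !mulgA catA.
Qed.

Lemma inv_adjE p i k : (p * adj i)^-1 k = p^-1 (adj i k).
Proof. by rewrite invMg tpermV permM. Qed.

Lemma adjL i : adj i (strand i) = strandS i. Proof. exact: tpermL. Qed.
Lemma adjR i : adj i (strandS i) = strand i. Proof. exact: tpermR. Qed.
Lemma adjD i k : k != strand i -> k != strandS i -> adj i k = k.
Proof. by move=> ki kS; rewrite /adj tpermD // eq_sym. Qed.

Lemma far_adj i j : far i j ->
  (adj j (strand i) = strand i) * (adj j (strandS i) = strandS i).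
Proof. by rewrite /far => ij; split; apply: adjD; rewrite -val_eqE /=; lia. Qed.

Lemma far_uniq s i j : far i j ->
  uniq [:: s (strand i); s (strandS i); s (strand j); s (strandS j)].
Proof.
move=> ij; rewrite -[uniq _]/(uniq (map s
  [:: strand i; strandS i; strand j; strandS j])) (map_inj_uniq perm_inj).
by rewrite /= !inE -!val_eqE /=; move: ij; rewrite /far; lia.
Qed.

Lemma strandSS i j : j = i.+1 :> nat -> strand j = strandS i.
Proof. by move=> ij; apply: val_inj. Qed.

Lemma adj_next i j : j = i.+1 :> nat ->
  (adj j (strand i) = strand i) * (adj i (strandS j) = strandS j).
Proof. by move=> ij; split; apply: adjD; rewrite -val_eqE /=; lia. Qed.

Lemma next_neq s i j : j = i.+1 :> nat ->
  s (strandS i) != s (strandS j) /\ s (strand i) != s (strandS j).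
Proof. by move=> ij; rewrite !(inj_eq perm_inj) -!val_eqE /= ij; split; lia. Qed.

(** A relation without rho's becomes a relation of the presentation with indices moved by [p^-1].
    Those with rho's give identical words on both sides, except the last two, which become
    [stvh_x_g] and [stvh_z_g]. *)
Lemma rewriting_rel u v p : stvb_rel u v ->
  cong (@stvh_rel n) (rewriting p u) (rewriting p v).
Proof.
case=> {u v} [i|i|i|k|i j ij|i j ij|i j ij|i j ij|i j ij|i j ij|i j ij|i j ij
  |i j ij|i j ij|i j ij|i j ij|i|k l|i k ki kS|i k ki kS|i k ki kS|i|i|i] /=;
  rewrite ?mulg1.
- exact/cong_rel/stvh_xK.
- exact/cong_rel/stvh_xVK.
- exact: cong_refl.
- exact/cong_rel/stvh_gammaK.
- exact/cong_rel/stvh_xx/far_uniq.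
- exact: cong_refl.
- have -> : X (perm_neq p^-1 (strand_neq i)) =
      X (perm_neq (p * adj j)^-1 (strand_neq i)).
    by apply: eq_X; rewrite inv_adjE far_adj.
  exact: cong_refl.
- exact/cong_rel/stvh_zz/far_uniq.
- exact/cong_rel/stvh_xz/far_uniq.
- have -> : Z (perm_neq p^-1 (strand_neq i)) =
      Z (perm_neq (p * adj j)^-1 (strand_neq i)).
    by apply: eq_Z; rewrite inv_adjE far_adj.
  exact: cong_refl.
- have [h ij'] := next_neq p^-1 ij.
  have -> : X (perm_neq p^-1 (strand_neq j)) = X h.
    by apply: eq_X; rewrite ?(strandSS ij).
  exact/cong_rel/stvh_xxx.
- exact: cong_refl.
(* Both middle letters are labelled by the images under [p^-1] of the strands [i] and [i + 2]. *)
- have -> : X (perm_neq (p * adj i)^-1 (strand_neq j)) =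
      X (perm_neq (p * adj j)^-1 (strand_neq i)).
    by apply: eq_X; rewrite !inv_adjE !(adj_next ij) -?(strandSS ij) ?adjL //
      (strandSS ij) adjR.
  exact: cong_refl.
- have -> : Z (perm_neq (p * adj i)^-1 (strand_neq j)) =
      Z (perm_neq (p * adj j)^-1 (strand_neq i)).
    by apply: eq_Z; rewrite !inv_adjE !(adj_next ij) -?(strandSS ij) ?adjL //
      (strandSS ij) adjR.
  exact: cong_refl.
- have [h ij'] := next_neq p^-1 ij.
  have -> : X (perm_neq p^-1 (strand_neq j)) = X h.
    by apply: eq_X; rewrite ?(strandSS ij).
  have -> : Z (perm_neq p^-1 (strand_neq j)) = Z h.
    by apply: eq_Z; rewrite ?(strandSS ij).
  exact/cong_rel/stvh_xxz.
- have [h ij'] := next_neq p^-1 ij.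
  have -> : X (perm_neq p^-1 (strand_neq j)) = X h.
    by apply: eq_X; rewrite ?(strandSS ij).
  have -> : Z (perm_neq p^-1 (strand_neq j)) = Z h.
    by apply: eq_Z; rewrite ?(strandSS ij).
  exact/cong_sym/cong_rel/stvh_zxx.
- exact/cong_rel/stvh_xz_same.
- exact/cong_rel/stvh_gg.
- have -> : p^-1 k = (p * adj i)^-1 k by rewrite inv_adjE adjD.
  exact: cong_refl.
- by apply/cong_sym/cong_rel/stvh_xg; rewrite (inj_eq perm_inj).
- by apply/cong_sym/cong_rel/stvh_zg; rewrite (inj_eq perm_inj).
- have -> : (p * adj i)^-1 (strand i) = p^-1 (strandS i) by rewrite inv_adjE adjL.
  exact: cong_refl.
(* After the prefix [p * adj i], the strands of [sigma i] carry their labels in reverse order. *)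
- have h : p^-1 (strandS i) != p^-1 (strand i).
    by rewrite eq_sym (inj_eq perm_inj) strand_neq.
  have -> : X (perm_neq (p * adj i)^-1 (strand_neq i)) = X h.
    by apply: eq_X; rewrite inv_adjE ?adjL ?adjR.
  exact/cong_rel/stvh_x_g.
- have h : p^-1 (strandS i) != p^-1 (strand i).
    by rewrite eq_sym (inj_eq perm_inj) strand_neq.
  have -> : Z (perm_neq (p * adj i)^-1 (strand_neq i)) = Z h.
    by apply: eq_Z; rewrite inv_adjE ?adjL ?adjR.
  exact/cong_rel/stvh_z_g.
Qed.

Lemma rewriting_cong u v p : cong (@stvb_rel n) u v ->
  cong (@stvh_rel n) (rewriting p u) (rewriting p v).
Proof.
move=> uv; elim: uv p => {u v}
  [u v uv|u|u v _ IH|u v w _ IH1 _ IH2|u u' v v' uu IHu vv IHv] p.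
- exact: rewriting_rel.
- exact: cong_refl.
- exact: cong_sym.
- exact: cong_trans (IH1 p) (IH2 p).
(* Congruent prefixes have the same image under $\varphi_2$, so both tails are read from the same
   permutation. *)
rewrite !rewriting_cat (weval_cong (@phi2_rel n) uu); exact: cong_cat.
Qed.

(** * Splitting a word into a pure part and a product of rho's *)

Lemma pure_letter_val a b : pure_letter a = [:: b] -> pw [:: a] = stvh_val b.
Proof.
case: a => // [i|i|i|k] [<-] //=.
- by rewrite /x_elt spread_strand.
- by rewrite /xV_elt spread_strand.
- by rewrite /z_elt spread_strand.
Qed.

Definition rho_indices u : seq 'I_n.-1 :=
  pmap (fun a => if a is Rho i then Some i else None) u.

Definition rho_prod (r : seq 'I_n.-1) : STVB n := \prod_(i <- r) rho i.

(** The last letter of [r] meets [b] first, so the adjacent transpositions act in reverse order;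
    hence the inverse. *)
Lemma rho_prod_val r b : rho_prod r * stvh_val b =
  stvh_val (gperm (\prod_(i <- r) adj i)^-1 b) * rho_prod r.
Proof.
rewrite /rho_prod; elim: r b => [|i r IHr] b.
  by rewrite !big_nil invg1 gperm1 mulg1 mul1g.
by rewrite !big_cons -mulgA IHr mulgA rho_val invMg gpermM tpermV mulgA.
Qed.

(** The rho's already read are kept as a word [r], because only [rho_prod_faithful] relates their
    product to its permutation. Each pure letter is carried leftwards through them. *)
Lemma rewriting_decomp r u :
  rho_prod r * pw u =
  val_word (rewriting (\prod_(i <- r) adj i) u) * rho_prod (r ++ rho_indices u).
Proof.
elim: u r => [|a u IHu] r.
  by rewrite /= cats0 /weval big_nil mul1g pword1 mulg1.
rewrite -cat1s pwordM mulgA.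
have [[i ->]|[b [ab a1 aN]]] : (exists i, a = Rho i) \/ exists b,
    [/\ pure_letter a = [:: b], phi2_gen a = 1 & rho_indices (a :: u) = rho_indices u].
- case: a => [i|i|i|i|k]; [right|right|left|right|right]; eexists; by [].
- have -> : rho_prod r * pw [:: Rho i] = rho_prod (rcons r i).
    by rewrite /rho_prod -cats1 big_cat big_seq1.
  by rewrite IHu /= -cats1 big_cat big_seq1 -catA.
rewrite (pure_letter_val ab) rho_prod_val -mulgA IHu aN /= ab a1 mulg1.
by rewrite /weval big_cons mulgA.
Qed.

Lemma rho_prod_faithful r : phi2 (rho_prod r) = 1 -> rho_prod r = 1.
Proof.
move=> r1; have rE : rho_prod r = rword (nat_ext (@rho n)) (map (@nat_of_ord _) r).
  exact: prod_rho.
(* The action of $S_n$ through $\varphi_2$, extended by the identity to the points from [n] on. *)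
pose act (q : STVB n) (x : nat) : nat :=
  if insub x is Some k then phi2 q k : 'I_n else x.
rewrite rE; apply: (coxeter_faithful (B := n.-1) (@nrhoK n) (@nrhoC n) (@nrhoB n)
  (act := act)) => [x|q q' x|m x mn||x].
- by rewrite /act gmulf1; case: insubP => // k _ <-; rewrite perm1.
- rewrite /act gmulfM; case: insubP => [k _ _|xn]; first by rewrite permM valK.
  by rewrite insubF // (negbTE xn).
- have -> : m = Ordinal mn by [].
  rewrite nat_extE /act phi2_pgen /=; case: insubP => [k _ <-|xn].
    exact: tperm_strand.
  by rewrite /nswap !ifN //; lia.
- by apply/allP => m /mapP[i _ ->].
- by rewrite -rE /act r1; case: insubP => // k _ <-; rewrite perm1.
Qed.

(** In the decomposition of [q] the pure part lies in the kernel, hence so does the product of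
    rho's, which is therefore trivial. *)
Lemma kernel_val_word (q : STVB n) : phi2 q = 1 ->
  q = val_word (rewriting 1 (repr q)).
Proof.
move=> q1; have := rewriting_decomp [::] (repr q).
rewrite /rho_prod !big_nil mul1g pword_repr -/(rho_prod _) /= => qE.
have v1 (v : seq (stvh_gen n)) : phi2 (val_word v) = 1.
  rewrite /weval; elim: v => [|b v IHv]; first by rewrite big_nil gmulf1.
  by rewrite big_cons gmulfM /= IHv (eqP (stvh_val_ker b)) mulg1.
rewrite {1}qE rho_prod_faithful ?mulg1 //.
by move: q1; rewrite {1}qE gmulfM /= v1 mul1g.
Qed.

(** The word is a single letter conjugated by rho's. Its rewriting is literally one letter, not
    merely congruent to one. *)
Lemma pure_word (b : stvh_gen n) : exists w, pw w = stvh_val b /\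
  forall p, rewriting p w = [:: gperm p^-1 b].
Proof.
have [a [b0 [s [ab0 bE]]]] : exists a b0 s, pure_letter a = [:: b0] /\ b = gperm s b0.
  case: b => [k l kl|k l kl|k l kl|k].
  - have [i [s [sk sl]]] := perm_std2 kl; subst k l.
    by exists (Sigma i), (X (strand_neq i)), s; split=> //; apply: eq_X.
  - have [i [s [sk sl]]] := perm_std2 kl; subst k l.
    by exists (SigmaInv i), (XInv (strand_neq i)), s; split=> //; apply: eq_XInv.
  - have [i [s [sk sl]]] := perm_std2 kl; subst k l.
    by exists (Tau i), (Z (strand_neq i)), s; split=> //; apply: eq_Z.
  - by exists (Gamma k), (HGamma k), 1; rewrite gperm1.
(* Labels are taken through the inverse of the prefix permutation, so a prefix spelling [s^-1] turns
   [b0] into [gperm s b0]. *)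
have [r rE] := adj_generate s^-1.
have wR t : pw (map (@Rho n) t) = rho_prod t.
  rewrite /rho_prod; elim: t => [|i t IHt]; first by rewrite big_nil.
  by rewrite big_cons -IHt -pwordM.
have rwR p t : rewriting p (map (@Rho n) t) = [::] by elim: t p => //=.
exists (map (@Rho n) r ++ a :: map (@Rho n) (rev r)); split=> [|p].
  rewrite pwordM -cat1s pwordM !wR (pure_letter_val ab0) mulgA rho_prod_val -rE.
  rewrite invgK -bE -mulgA; have := prod_rho_revK (rev r); rewrite revK => ->.
  exact: mulg1.
rewrite rewriting_cat rwR /= ab0 rwR /=; congr [:: _].
have -> : weval (@phi2_gen n) (map (@Rho n) r) = s^-1 by rewrite rE /weval big_map.
by rewrite invMg invgK gpermM -bE.
Qed.

Lemma pure_words (v : seq (stvh_gen n)) : exists w, pw w = val_word v /\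
  rewriting 1 w = v.
Proof.
elim: v => [|b v [w' [wv rv]]]; first by exists [::]; rewrite /weval big_nil.
have [w [wb rb]] := pure_word b; exists (w ++ w').
(* [w] represents an element of the kernel, so [w'] is still read from the identity permutation. *)
have w1 : weval (@phi2_gen n) w = 1.
  have := stvh_val_ker b; rewrite inE -wb => /eqP <-.
  exact/esym/(plift_pword (@phi2_rel n)).
rewrite pwordM wb wv /weval big_cons; split=> //.
by rewrite rewriting_cat w1 mulg1 rv rb invg1 gperm1.
Qed.

End Rewriting.

(** * The isomorphism with the kernel *)

Lemma weval_elt n v : val (weval (@stvh_elt n) v) = weval (@stvh_val n) v.
Proof.
rewrite /weval; elim: v => [|b v IHv]; first by rewrite !big_nil.
by rewrite !big_cons -IHv.
Qed.

Lemma stvh_rel_elt n u v : stvh_rel u v ->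
  weval (@stvh_elt n) u = weval (@stvh_elt n) v.
Proof. by move=> uv; apply: val_inj; rewrite !weval_elt; exact: stvh_rel_val. Qed.

Definition stvh_map n : presented (@stvh_rel n) -> STVH n := plift (@stvh_elt n).

HB.instance Definition _ n :=
  isUMagmaMorphism.Build (presented (@stvh_rel n)) (STVH n) (@stvh_map n)
    (plift_monoid_morphism (@stvh_rel_elt n)).

Theorem theorem3p3 (n : nat) (n_gt0 : 0 < n) :
  has_presentation (@stvh_elt n) (@stvh_rel n).
Proof.
have mapE v : stvh_map (pword (@stvh_rel n) v) = weval (@stvh_elt n) v.
  exact/plift_pword/stvh_rel_elt.
exists (@stvh_map n); split=> [b|]; first by rewrite /= mapE /weval big_seq1.
exists (fun q => pword (@stvh_rel n) (rewriting 1 (repr (val q)))) => [q|q] /=.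
  (* The representative of [q] is itself the rewriting of a word [w] with the same value. The
     representative chosen in $STVB_n$ is congruent to [w], so its rewriting is congruent to that of
     [w]. *)
  rewrite -(pword_repr q) mapE weval_elt; have [w [<- wq]] := pure_words (repr q).
  by rewrite -[in RHS]wq; exact/pword_eq/rewriting_cong/cong_repr.
apply: val_inj; rewrite mapE weval_elt -kernel_val_word //.
by apply/eqP; exact: (valP q).
Qed.
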